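(* For every integer $n\geq 0$, $$\sum_{k=0}^{n}(k+1)A_{n,k}=(n+2)B_{n+1}-V_{n+3},\qquad \sum_{k=0}^{n}(n-k+1)A_{n,k}=V_{n+3}-(n+2)V_{n+1}.$$
   Context: A partition of a finite set is a collection of nonempty, pairwise disjoint subsets (blocks) whose union is the set; a singleton of a partition is a block with exactly one element. $B_n$ denotes the $n$-th Bell number ($B_0=1$), and $V_n$ the number of partitions of $\{1,\dots,n\}$ with no singletons ($V_0=1$). For integers $0\leq k\leq n$, $A_{n,k}$ denotes the number of partitions of $\{1,2,\dots,n+1\}$ whose largest singleton is $k+1$ (i.e. $\{k+1\}$ is a block and no $j>k+1$ forms a singleton block). *)

(* Defs.v *)
From mathcomp Require Import all_boot all_order all_algebra.

Set Implicit Arguments.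
Unset Strict Implicit.
Unset Printing Implicit Defensive.

(* The set {1, ..., n} is represented by 'I_n, with i : 'I_n standing for i + 1. *)

Definition set_partitions (n : nat) : {set {set {set 'I_n}}} :=
  [set P | partition P [set: 'I_n]].

Definition singleton_of (n : nat) (P : {set {set 'I_n}}) (i : 'I_n) : bool :=
  [set i] \in P.

Definition Bell (n : nat) : nat := #|set_partitions n|.

Definition V (n : nat) : nat :=
  #|[set P in set_partitions n | [forall i, ~~ singleton_of P i]]|.

(* The index k : 'I_n.+1 ranges over 0 <= k <= n, and as an element of the
   partitioned set it stands for k + 1. *)
Definition A (n : nat) (k : 'I_n.+1) : nat :=
  #|[set P in set_partitions n.+1 |
      singleton_of P k && [forall j : 'I_n.+1, (k < j) ==> ~~ singleton_of P j]]|.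

(* Main.v *)
(** Deleting the largest singleton [k] identifies [A_{n,k}] with the number of
    partitions of an [n]-set in which the last [n - k] elements are not
    singletons.  Classifying the latter by their own largest singleton [i < k]
    (or its absence) gives [A_{n+1,k} = V_{n+1} + \sum_{i<k} A_{n,i}].

    Gathering the singletons of a partition of an [n]-set into the block of a
    new point gives [B_n = V_{n+1} + V_n].  Together with
    [B_{n+1} = V_{n+1} + \sum_k A_{n,k}] this yields
    [V_{n+2} = \sum_k A_{n,k}].  Expanding [V_{n+3} = \sum_k A_{n+1,k}] by the
    first identity and exchanging the sums is the second formula; the first
    follows because the two left-hand sides add up to [(n+2) \sum_k A_{n,k}]. *)

Require Import Defs.
From mathcomp Require Import all_boot all_order all_algebra.
From mathcomp Require Import zify ring.
Set Implicit Arguments.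
Unset Strict Implicit.
Unset Printing Implicit Defensive.

Import Order.TTheory GRing.Theory Num.Theory.
Local Open Scope ring_scope.

(** * Counting partitions in which prescribed points are not singletons *)

Lemma card_bij_in (S T : finType) (A : {set S}) (B : {set T})
    (f : S -> T) (g : T -> S) :
  {in A, forall x, f x \in B} -> {in B, forall y, g y \in A} ->
  {in A, cancel f g} -> {in B, cancel g f} -> #|A| = #|B|.
Proof.
move=> fAB gBA fK gK; rewrite -(card_in_imset (can_in_inj fK)).
congr #|pred_of_set _|; apply/setP => y; apply/imsetP/idP => [[x Ax ->]|By].
  exact: fAB.
by exists (g y); [exact: gBA | rewrite gK].
Qed.

(** One family covers all three counts: [S] empty gives [Bell], [S] full gives [V], and an upper
    segment gives [A]. A ground set [D] inside a fixed type lets points be added or deleted without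
    changing type. *)
Definition partitions_avoiding (T : finType) (D S : {set T}) :
    {set {set {set T}}} :=
  [set P | partition P D && [forall x in S, [set x] \notin P]].

Lemma partitions_avoidingP (T : finType) (D S : {set T}) (P : {set {set T}}) :
  reflect (partition P D /\ {in S, forall x, [set x] \notin P})
          (P \in partitions_avoiding D S).
Proof.
rewrite inE; apply: (iffP andP) => -[PD PS]; split=> //.
  by move=> x Sx; exact: (forall_inP PS).
exact/forall_inP.
Qed.

Section FiniteType.
Variable T : finType.
Implicit Types (x z : T) (B D S : {set T}) (P Q : {set {set T}}).

Lemma card_partitions_avoiding_imset (T' : finType) (f : T -> T') D S :
  injective f ->
  #|partitions_avoiding (f @: D) (f @: S)| = #|partitions_avoiding D S|.
Proof.
move=> f_inj; apply/esym.
(* Blocks of [Q] lie in the range of [f], so taking preimages and then images loses nothing. *)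
have fD (Q : {set {set T'}}) : partition Q (f @: D) ->
    [set f @: (B : {set T}) | B in [set f @^-1: (B : {set T'}) | B in Q]] = Q.
  move=> QD; rewrite -imset_comp -[RHS]imset_id.
  apply: eq_in_imset => B QB /=; apply/setP => y.
  apply/imsetP/idP => [[x] | By]; first by rewrite inE => Bx ->.
  have /imsetP[x _ y_fx] := subsetP (partitionS QD QB) y By.
  by exists x; rewrite // inE -y_fx.
apply: (@card_bij_in _ _ _ _ (fun P : {set {set T}} => [set f @: (B : {set T}) | B in P])
  (fun Q : {set {set T'}} => [set f @^-1: (B : {set T'}) | B in Q])).
- move=> P /partitions_avoidingP[PD PS]; apply/partitions_avoidingP.
  split; first by rewrite imset_partition.
  move=> _ /imsetP[x Sx ->]; rewrite -imset_set1 mem_imset ?PS //.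
  exact: imset_inj.
- move=> Q /partitions_avoidingP[QD QS]; apply/partitions_avoidingP.
  split; first by rewrite -(imset_partition _ _ f_inj) fD.
  move=> x Sx; apply: contra (QS _ (imset_f f Sx)) => Qx.
  by rewrite -(fD _ QD) -imset_set1 mem_imset //; exact: imset_inj.
- move=> P _ /=; rewrite -imset_comp -[RHS]imset_id; apply: eq_in_imset => B _ /=.
  by apply/setP => x; rewrite inE mem_imset.
- by move=> Q /partitions_avoidingP[/fD].
Qed.

(** The bijection removes the block [[set z]]; putting it back breaks no constraint because [z] lies
    outside [S]. *)
Lemma card_partitions_avoiding_isolated z D S : z \notin D -> S \subset D ->
  #|[set P in partitions_avoiding (z |: D) S | [set z] \in P]|
    = #|partitions_avoiding D S|.
Proof.
move=> zD SD.
apply: (@card_bij_in _ _ _ _ (fun P => P :\ [set z]) (fun P => [set z] |: P)).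
- move=> P; rewrite inE => /andP[/partitions_avoidingP[PD PS] Pz].
  apply/partitions_avoidingP; split; last first.
    by move=> x Sx; apply: contra (PS x Sx); rewrite inE => /andP[].
  by have := partitionD1 PD Pz; rewrite setU1K.
- move=> P /partitions_avoidingP[PD PS]; rewrite inE setU11 andbT.
  apply/partitions_avoidingP; split.
    apply: partitionU1 => //; last by rewrite disjoints1.
    by apply/set0Pn; exists z; rewrite set11.
  move=> x Sx; rewrite in_setU1 negb_or PS // andbT.
  apply: contraNneq zD => /set1_inj <-; exact: (subsetP SD).
- by move=> P; rewrite inE => /andP[_ Pz]; rewrite setD1K.
- move=> P /partitions_avoidingP[PD _]; rewrite setU1K //.
  by apply: contra zD => /(partitionS PD); rewrite sub1set.
Qed.

Lemma card_partitions_avoiding_split z D S : z \notin S ->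
  #|partitions_avoiding D S| = (#|partitions_avoiding D (z |: S)|
    + #|[set P in partitions_avoiding D S | [set z] \in P]|)%N.
Proof.
move=> zS; rewrite -(cardsID [set P : {set {set T}} | [set z] \in P]) addnC.
congr (_ + _)%N; congr #|pred_of_set _|; apply/setP => P; last by rewrite !inE.
rewrite 2!inE; apply/andP/partitions_avoidingP.
  move=> [Pz /partitions_avoidingP[PD PS]]; split=> // x.
  by rewrite in_setU1 => /predU1P[-> // | /PS].
move=> [PD PS]; split; first by rewrite PS ?setU11.
by apply/partitions_avoidingP; split=> // x Sx; rewrite PS ?setU1r.
Qed.

Definition gather_singletons z P : {set {set T}} :=
  (z |: [set x | [set x] \in P]) |: [set B in P | #|B| != 1%N].

(** The inverse of gathering: the other members of the block of [z] become singletons, and [z]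
    disappears. *)
Definition scatter_block z P : {set {set T}} :=
  (P :\ pblock P z) :|: [set [set x] | x in pblock P z :\ z].

Lemma partition_gather_singletons z D P : z \notin D -> partition P D ->
  partition (gather_singletons z P) (z |: D).
Proof.
move=> zD PD; set s := [set x | [set x] \in P].
have sD : s \subset D.
  by apply/subsetP => x; rewrite inE => /(partitionS PD); rewrite sub1set.
have -> : z |: D = (z |: s) :|: (D :\: s).
  by rewrite -setUA -{1}(setID D s) (setIidPr sD).
apply: partitionU1.
- apply/and3P; split.
  + apply/eqP/setP => x; rewrite !inE; apply/bigcupP/andP.
      (* If [[set x]] were a block, it would equal the block [B] through [x], against
         [#|B| != 1]. *)
      move=> [B]; rewrite inE => /andP[PB B1] Bx; split; last first.
        exact: (subsetP (partitionS PD PB)).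
      apply: contra B1 => Px.
      have /eqP := def_pblock (partition_trivIset PD) Px (set11 x).
      rewrite (def_pblock (partition_trivIset PD) PB Bx) => /eqP ->.
      by rewrite cards1.
    move=> [Px Dx]; move: Dx; rewrite -(cover_partition PD).
    move=> /bigcupP[B PB Bx]; exists B => //; rewrite inE PB /=.
    apply: contra Px => /cards1P[y By]; move: Bx PB.
    by rewrite By => /set1P ->.
  + apply: trivIsetS (partition_trivIset PD).
    by apply/subsetP => B; rewrite inE => /andP[].
  + by rewrite inE (partition0 PD).
- by apply/set0Pn; exists z; rewrite setU11.
- apply/pred0P => x; rewrite !inE; case: eqP => [->|_] /=.
    by rewrite (negPf zD) andbF.
  by case: (_ \in P).
Qed.

Lemma partition_scatter_block z D P : z \notin D -> partition P (z |: D) ->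
  partition (scatter_block z P) D.
Proof.
move=> zD PD; have tiP := partition_trivIset PD.
have Cz : z \in pblock P z.
  by rewrite mem_pblock (cover_partition PD) setU11.
have PC : pblock P z \in P by rewrite pblock_mem // -mem_pblock.
have CD : pblock P z :\ z \subset D.
  by rewrite subDset (partitionS PD PC).
(* As [z] is not in [D], removing its whole block from [z |: D] leaves the same set as removing its
   companions from [D]. *)
have PD' : partition (P :\ pblock P z) (D :\: (pblock P z :\ z)).
  have := partitionD1 PD PC; congr partition; apply/setP => x.
  rewrite !inE; case: (eqVneq x z) => [->|_] /=.
    by rewrite Cz (negPf zD).
  by [].
apply/and3P; split.
- rewrite /cover bigcup_setU -/(cover _) (cover_partition PD').
  apply/eqP/setP => x; rewrite inE in_setD.
  have -> : (x \in \bigcup_(B in [set [set x] | x in pblock P z :\ z]) B)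
      = (x \in pblock P z :\ z).
    apply/bigcupP/idP => [[_ /imsetP[y Cy ->]] /set1P -> // | Cx].
    by exists [set x]; rewrite ?set11 ?imset_f.
  case: (boolP (x \in _ :\ _)) => //= [/(subsetP CD) -> | _];
    by rewrite ?orbT ?orbF.
- apply: trivIsetU.
  + exact: partition_trivIset PD'.
  + apply/trivIsetP => _ _ /imsetP[x _ ->] /imsetP[y _ ->] xy.
    by rewrite disjoints1 inE; apply: contraNneq xy => ->.
  + rewrite (cover_partition PD'); apply/pred0P => x /=; rewrite inE.
    apply/negP => /andP[/andP[Cx _] /bigcupP[_ /imsetP[y Cy ->] /set1P xy]].
    by rewrite xy Cy in Cx.
- rewrite inE negb_or (partition0 PD') /=.
  by apply/imsetP => -[x _ /setP/(_ x)]; rewrite !inE eqxx.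
Qed.

(* Gathering the singletons of a partition of [D] into the block of the new
   point [z] leaves no singleton except possibly [z] itself. *)
Lemma card_partitions_avoiding_gather z D : z \notin D ->
  #|partitions_avoiding (z |: D) D| = #|partitions_avoiding D set0|.
Proof.
move=> zD; apply/esym.
apply: (@card_bij_in _ _ _ _ (gather_singletons z) (scatter_block z)).
- move=> P /partitions_avoidingP[PD _]; apply/partitions_avoidingP.
  split; first exact: partition_gather_singletons.
  move=> x Dx; rewrite !inE cards1 eqxx andbF orbF.
  apply/eqP => /setP/(_ z); rewrite !inE eqxx => /eqP zx.
  by rewrite zx Dx in zD.
- move=> P /partitions_avoidingP[PD _]; apply/partitions_avoidingP.
  by split=> [|x]; [exact: partition_scatter_block | rewrite inE].
- move=> P /partitions_avoidingP[PD _].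
  (* Hence the gathered block is new, and deleting it undoes its insertion. *)
  have zP B : B \in P -> z \notin B.
    by move=> PB; apply: contra zD; apply: (subsetP (partitionS PD PB)).
  have tiG := partition_trivIset (partition_gather_singletons zD PD).
  rewrite /scatter_block (def_pblock tiG (setU11 _ _) (setU11 _ _)).
  rewrite !setU1K; last first.
    by rewrite inE; apply: contraL (set11 z) => /zP.
  + rewrite inE; apply/negP => /andP[/zP]; by rewrite setU11.
  apply/setP => B; rewrite !inE; apply/orP/idP.
    by move=> [/andP[] // | /imsetP[x]]; rewrite inE => Px ->.
  move=> PB; case: (boolP (#|B| == 1%N)) => B1; last by left; rewrite PB.
  by right; have /cards1P[x Bx] := B1; rewrite Bx imset_f // inE -Bx.
- move=> P /partitions_avoidingP[PD PS]; have tiP := partition_trivIset PD.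
  have Cz : z \in pblock P z.
    by rewrite mem_pblock (cover_partition PD) setU11.
  have PC : pblock P z \in P by rewrite pblock_mem // -mem_pblock.
  (* The only possible singleton block is that of [z], so the singletons after scattering are
     exactly the scattered points. *)
  have P1 x : [set x] \in P -> [set x] = pblock P z.
    move=> Px; have := partitionS PD Px; rewrite sub1set in_setU1.
    move=> /predU1P[xz | /PS]; last by rewrite Px.
    by apply/esym/(def_pblock tiP Px); rewrite xz set11.
  rewrite /gather_singletons -[RHS](setD1K PC); congr (_ |: _).
    apply/setP => x; rewrite !inE; case: (eqVneq x z) => [-> // | xz] /=.
    apply/orP/idP => [[/andP[xC /P1 xC'] | /imsetP[y]] | Cx].
    + by rewrite xC' eqxx in xC.
    + by rewrite !inE => /andP[_ Cy] /set1_inj ->.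
    + by right; rewrite imset_f // !inE xz.
  apply/setP => B; rewrite inE in_setU andb_orl.
  have -> : (B \in [set [set x] | x in pblock P z :\ z]) && (#|B| != 1%N) = false.
    by apply/negP => /andP[/imsetP[x _ ->]]; rewrite cards1.
  rewrite orbF; case: (boolP (B \in P :\ _)) => //=.
  rewrite !inE => /andP[BC PB]; apply: contra BC => /cards1P[x Bx].
  by rewrite Bx P1 // -Bx.
Qed.

End FiniteType.

(** * [Bell], [V] and [A] as counts of avoiding partitions, and their recurrences *)

Lemma BellE n : Bell n = #|partitions_avoiding [set: 'I_n] set0|.
Proof.
congr #|pred_of_set _|; apply/setP => P; rewrite !inE.
by rewrite (introT forall_inP) ?andbT // => x; rewrite inE.
Qed.

Lemma VE n : V n = #|partitions_avoiding [set: 'I_n] setT|.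
Proof.
congr #|pred_of_set _|; apply/setP => P; rewrite !inE; congr (_ && _).
by apply: eq_forallb => x; rewrite inE.
Qed.

Lemma imset_liftT n (k : 'I_n.+1) : lift k @: [set: 'I_n] = [set~ k].
Proof.
apply/setP => j; rewrite !inE; apply/imsetP/idP => [[i _ ->] | jk].
  by rewrite eq_sym neq_lift.
by rewrite eq_sym in jk; have [i -> _] := unlift_some jk; exists i.
Qed.

Lemma setU1C (T : finType) (z : T) : z |: [set~ z] = setT.
Proof. by apply/setP => x; rewrite !inE orbN. Qed.

Lemma A_isolated n (k : 'I_n.+1) :
  A k = #|[set P in partitions_avoiding setT [set j : 'I_n.+1 | (k < j)%N]
         | [set k] \in P]|.
Proof.
congr #|pred_of_set _|; apply/setP => P.
rewrite !inE -andbA [_ && ([set k] \in P)]andbC.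
by congr (_ && (_ && _)); apply: eq_forallb => j; rewrite inE.
Qed.

Lemma AE n (k : 'I_n.+1) :
  A k = #|partitions_avoiding [set: 'I_n] [set j : 'I_n | (k <= j)%N]|.
Proof.
have kD : k \notin [set~ k] by rewrite !inE eqxx.
have SD : [set j : 'I_n.+1 | (k < j)%N] \subset [set~ k].
  by apply/subsetP => j; rewrite !inE; apply: contraTneq => ->; rewrite ltnn.
rewrite -(card_partitions_avoiding_imset _ _ (@lift_inj _ k)).
(* [lift k] skips [k] and shifts indices from [k] on up by one, so the weak bound becomes strict. *)
have -> : lift k @: [set j : 'I_n | (k <= j)%N] = [set j : 'I_n.+1 | (k < j)%N].
  apply/setP => j; rewrite !inE; apply/imsetP/idP => [[i] | kj].
    by rewrite inE => ki -> /=; rewrite /bump ki.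
  have jk : k != j by rewrite neq_ltn kj.
  have [i ij _] := unlift_some jk; exists i => //; rewrite inE.
  by move: kj; rewrite ij /= /bump; lia.
rewrite imset_liftT -(card_partitions_avoiding_isolated kD SD) setU1C.
exact: A_isolated.
Qed.

Lemma Bell_eq_VD n : Bell n = (V n.+1 + V n)%N.
Proof.
have kD : (ord0 : 'I_n.+1) \notin [set~ ord0] by rewrite !inE eqxx.
have lift_inj0 := @lift_inj _ (ord0 : 'I_n.+1).
rewrite BellE -(card_partitions_avoiding_imset _ _ lift_inj0) imset0 imset_liftT.
rewrite -(card_partitions_avoiding_gather kD).
(* After gathering, the new point may or may not be alone: if not, no singleton remains; if so,
   deleting it leaves a singleton-free partition of [n] points. *)
rewrite (card_partitions_avoiding_split _ kD) setU1C -VE; congr (_ + _)%N.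
rewrite VE -(card_partitions_avoiding_imset _ _ lift_inj0) imset_liftT.
by rewrite -(card_partitions_avoiding_isolated kD (subxx _)) setU1C.
Qed.

(** Raising [m] by one frees the point [m]; the partitions gained are those whose largest singleton
    is [m]. At [m = 0] every singleton is forbidden. *)
Lemma card_partitions_avoiding_final n m : (m <= n.+1)%N ->
  #|partitions_avoiding [set: 'I_n.+1] [set j : 'I_n.+1 | (m <= j)%N]|
    = (V n.+1 + \sum_(k < n.+1 | (k < m)%N) A k)%N.
Proof.
elim: m => [_|m IHm m_lt_n].
  rewrite big_pred0_eq addn0 VE.
  by congr #|pred_of_set (partitions_avoiding _ _)|.
pose k := Ordinal m_lt_n.
rewrite (card_partitions_avoiding_split (z := k)) ?inE ?ltnn //.
have -> : k |: [set j : 'I_n.+1 | (m < j)%N] = [set j : 'I_n.+1 | (m <= j)%N].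
  by apply/setP => j; rewrite !inE -val_eqE /=; lia.
rewrite (IHm (ltnW m_lt_n)) -addnA; congr (_ + _)%N.
rewrite [RHS](bigD1 k) //= A_isolated addnC; congr (_ + _)%N.
by apply: eq_bigl => j; rewrite -val_eqE /=; lia.
Qed.

Lemma Bell_eq_V_sumA n : Bell n.+1 = (V n.+1 + \sum_(k < n.+1) A k)%N.
Proof.
have -> : (\sum_(k < n.+1) A k = \sum_(k < n.+1 | (k < n.+1)%N) A k)%N.
  by apply: eq_bigl => k; rewrite ltn_ord.
rewrite -card_partitions_avoiding_final // BellE.
congr #|pred_of_set (partitions_avoiding _ _)|.
by apply/setP => j; rewrite !inE leqNgt ltn_ord.
Qed.

Lemma V_eq_sumA n : V n.+2 = (\sum_(k < n.+1) A k)%N.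
Proof. by have := Bell_eq_V_sumA n; rewrite Bell_eq_VD; lia. Qed.

Lemma sum_const_ord_gt m k a :
  (\sum_(j < m | (k < j)%N) a = (m - k.+1) * a)%N.
Proof.
elim: m => [|m IHm]; first by rewrite big_ord0.
rewrite big_mkcond big_ord_recr -big_mkcond /= IHm subSS.
(* For [m <= k] the sum gains no term and both truncated differences vanish. *)
by case: ltnP => km; [rewrite -mulSnr subnSK | move: km; lia].
Qed.

Lemma V_eq_weighted_sumA n :
  V n.+3 = (n.+2 * V n.+1 + \sum_(k < n.+1) (n.+1 - k) * A k)%N.
Proof.
rewrite V_eq_sumA.
under eq_bigr => j _ do rewrite AE card_partitions_avoiding_final -1?ltnS //.
rewrite big_split /= sum_nat_const card_ord; congr (_ + _)%N.
(* Each [A k] is counted once for every [j] with [k < j < n.+2], that is [n.+1 - k] times. *)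
rewrite (exchange_big_dep predT) //=; apply: eq_bigr => k _.
exact: sum_const_ord_gt.
Qed.

Theorem theorem3p10 (n : nat) :
  \sum_(k < n.+1) (k%:Z + 1) * (A k)%:Z
    = (n%:Z + 2) * (Bell (n + 1))%:Z - (V (n + 3))%:Z
  /\
  \sum_(k < n.+1) (n%:Z - k%:Z + 1) * (A k)%:Z
    = (V (n + 3))%:Z - (n%:Z + 2) * (V (n + 1))%:Z.
Proof.
rewrite addn1 addn3.
have second : \sum_(k < n.+1) (n%:Z - k%:Z + 1) * (A k)%:Z
    = (V n.+3)%:Z - (n%:Z + 2) * (V n.+1)%:Z.
  rewrite V_eq_weighted_sumA PoszD PoszM (big_morph Posz PoszD erefl).
  rewrite (_ : n.+2%:Z = n%:Z + 2); last by lia.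
  rewrite addrAC subrr add0r.
  apply: eq_bigr => k _; rewrite PoszM; congr (_ * _).
  (* The bound [k < n.+1] makes the truncated [n.+1 - k] agree with the integer weight. *)
  by have := ltn_ord k; lia.
split=> //; rewrite Bell_eq_V_sumA PoszD (big_morph Posz PoszD erefl).
have -> : \sum_(k < n.+1) (k%:Z + 1) * (A k)%:Z
    = (n%:Z + 2) * (\sum_(k < n.+1) (A k)%:Z)
      - \sum_(k < n.+1) (n%:Z - k%:Z + 1) * (A k)%:Z.
  by rewrite mulr_sumr -sumrB; apply: eq_bigr => k _; ring.
by rewrite second; ring.
Qed.
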